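(* Let $\phi:\mathbb{R}\to\mathbb{R}$ be a nondecreasing, convex function that is $L$-Lipschitz for some $L>0$. Let $X$ and $Y$ be random variables with CDFs $F_X$ and $F_Y$, respectively, such that $\phi(X)$ and $\phi(Y)$ are integrable and the optimized certainty equivalent risks $\mathrm{oce}_\phi(X)$ and $\mathrm{oce}_\phi(Y)$ are finite. Then $$|\mathrm{oce}_\phi(X)-\mathrm{oce}_\phi(Y)|\le L\,W_1(F_X,F_Y).$$
   Context: For a nondecreasing convex disutility function $\phi$ and a random variable $X$ with $\phi(X)$ integrable, the optimized certainty equivalent (OCE) risk is $\mathrm{oce}_\phi(X)=\inf_{\xi\in\mathbb{R}}\{\xi+\mathbb{E}[\phi(X-\xi)]\}$. $W_1$ is the 1-Wasserstein distance between CDFs on $\mathbb{R}$: $W_1(F_1,F_2)=\inf\int_{\mathbb{R}^2}|x-y|\,dF(x,y)$ over joint distributions $F$ with marginals $F_1,F_2$ (possibly $+\infty$); equivalently $W_1(F_1,F_2)=\int_{-\infty}^{\infty}|F_1(s)-F_2(s)|\,ds$. *)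

(* Defs.v *)
From mathcomp Require Import all_boot all_order all_algebra.
From mathcomp Require Import all_classical all_reals all_analysis.

Set Implicit Arguments.
Unset Strict Implicit.
Unset Printing Implicit Defensive.
Import Order.TTheory GRing.Theory Num.Theory.
Import numFieldNormedType.Exports.

Local Open Scope classical_set_scope.
Local Open Scope ring_scope.
Local Open Scope ereal_scope.

Definition oce (R : realType) (phi : R -> R) (d : measure_display)
    (T : measurableType d) (P : probability T R) (X : {RV P >-> R}) : \bar R :=
  ereal_inf [set xi%:E + 'E_P[fun w => phi (X w - xi)%R] | xi in [set: R]].

(* A joint distribution is a Borel probability measure [pi] on the plane.  Since
   [W1] is a distance between CDFs, its marginals are prescribed through the
   CDFs of the two coordinates. *)
Definition coupling (R : realType) (F1 F2 : R -> \bar R)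
    (pi : probability (R * R)%type R) : Prop :=
  (forall s, pi [set z | (z.1 <= s)%R] = F1 s) /\
  (forall s, pi [set z | (z.2 <= s)%R] = F2 s).

Definition W1 (R : realType) (F1 F2 : R -> \bar R) : \bar R :=
  ereal_inf [set \int[pi]_z `|z.1 - z.2|%:E |
             pi in [set pi : probability (R * R)%type R | coupling F1 F2 pi]].

(* Main.v *)
(* The OCE risk depends only on the law of the random variable, and the law is
   determined by the CDF. Under a coupling [pi], [X] and [Y] may therefore be
   replaced by the two coordinates on the plane, where for each [xi] the
   Lipschitz bound phi (x - xi) <= phi (y - xi) + L |x - y| integrates to
   E[phi (X - xi)] <= E[phi (Y - xi)] + L E|X - Y|. Take the infimum over [xi],
   exchange the roles of [X] and [Y], then take the infimum over [pi]. *)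
Require Import Defs.
From mathcomp Require Import all_boot all_order all_algebra.
From mathcomp Require Import all_classical all_reals all_analysis.
From mathcomp Require Import measurable_realfun.

Import Order.TTheory GRing.Theory Num.Theory.
Import numFieldNormedType.Exports.
Local Open Scope classical_set_scope.
Local Open Scope ring_scope.
Local Open Scope ereal_scope.

(** The open rays []a, +oo[] generate the Borel sets and are closed under intersection. Two finite
    measures that agree on them agree everywhere, and the measure of such a ray is one minus that of
    its complement []-oo, a]]. *)
Lemma probability_eq_cdf (R : realType) (P Q : probability R R) :
    (forall s : R, P `]-oo, s]%classic = Q `]-oo, s]%classic) ->
  forall A, measurable A -> P A = Q A.
Proof.
move=> PQ; apply: (measure_unique (@RGenOInfty.G R)
  (fun n => `](- n%:R)%R, +oo[%classic)).
- exact: RGenOInfty.measurableE.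
- move=> _ _ [a ->] [b ->]; exists (Num.max a b).
  by apply/seteqP; split => x /=; rewrite !in_itv/= !andbT gt_max => /andP.
- by move=> n; exists (- n%:R)%R.
(* The rays starting at [-n] exhaust the line: the chosen index exceeds [|x|], hence also [-x]. *)
- apply/seteqP; split => // x _; exists (Num.truncn `|x|).+1 => //=.
  rewrite in_itv/= andbT ltrNl (le_lt_trans _ (truncnS_gt _))//.
  by rewrite -normrN ler_norm.
- move=> _ [a ->]; rewrite -setCitvl.
  by rewrite [LHS](probability_setC P)// [RHS](probability_setC Q)// PQ.
- by move=> n; rewrite -ge0_fin_numE// fin_num_measure//.
Qed.

Section law_invariance.
Context (R : realType) (d d' : measure_display)
  (T : measurableType d) (T' : measurableType d')
  (P : probability T R) (P' : probability T' R)
  (X : {RV P >-> R}) (Y : {RV P' >-> R}).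
Hypothesis XY : cdf X =1 cdf Y.

Lemma ge0_integral_eq_cdf (h : R -> \bar R) :
    measurable_fun [set: R] h -> (forall x, 0 <= h x) ->
  \int[P]_w h (X w) = \int[P']_w h (Y w).
Proof.
move=> mh h0.
rewrite -(ge0_integral_distribution X mh h0).
rewrite -(ge0_integral_distribution Y mh h0).
by apply: eq_measure_integral => A mA _; exact: probability_eq_cdf.
Qed.

(** The integral is the difference of the integrals of the positive and negative parts, so the
    nonnegative case applies to each part. *)
Lemma integral_eq_cdf (h : R -> \bar R) : measurable_fun [set: R] h ->
  \int[P]_w h (X w) = \int[P']_w h (Y w).
Proof.
move=> mh; rewrite integralE [RHS]integralE.
rewrite (funepos_comp h X) (funepos_comp h Y).
rewrite (funeneg_comp h X) (funeneg_comp h Y).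
congr (_ - _); apply: ge0_integral_eq_cdf => //.
- exact: measurable_funepos.
- exact: measurable_funeneg.
Qed.

Lemma integrable_eq_cdf (h : R -> \bar R) : measurable_fun [set: R] h ->
  P.-integrable [set: T] (h \o X) -> P'.-integrable [set: T'] (h \o Y).
Proof.
move=> mh /integrableP[_ hX]; apply/integrableP; split.
  exact: measurableT_comp.
rewrite -(ge0_integral_eq_cdf (fun x => `|h x|))//.
exact: measurableT_comp.
Qed.

Lemma oce_eq_cdf (phi : R -> R) : measurable_fun [set: R] phi ->
  oce phi X = oce phi Y.
Proof.
move=> mphi; rewrite /oce; congr ereal_inf; apply: eq_imagel => xi _.
congr (_ + _); rewrite unlock.
apply: (integral_eq_cdf (fun x => (phi (x - xi))%:E)).
apply/measurable_EFinP; apply: measurableT_comp => //.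
exact: measurable_funB.
Qed.

End law_invariance.
Arguments integrable_eq_cdf {R d d' T T' P P' X Y} XY {h}.
Arguments oce_eq_cdf {R d d' T T' P P' X Y} XY {phi}.

Section lipschitz.
Context (R : realType) (phi : R -> R) (L : R).
Hypotheses (L0 : (0 <= L)%R) (mphi : measurable_fun [set: R] phi)
  (phiL : forall x y, (`|phi x - phi y| <= L * `|x - y|)%R).
Context (d : measure_display) (T : measurableType d) (P : probability T R).

(** The shifted variable is dominated by [|phi X| + L |xi|], and constants are integrable under a
    probability. *)
Lemma integrable_lipschitz_shift (X : {RV P >-> R}) (xi : R) :
    P.-integrable [set: T] (EFin \o (phi \o X)) ->
  P.-integrable [set: T] (fun w => (phi (X w - xi))%:E).
Proof.
move=> iX.
have iB : P.-integrable [set: T]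
    (fun w => `|(phi (X w))%:E| + (L * `|xi|)%:E).
  apply: integrableD => //; first exact: (integrable_abse iX).
  exact: (finite_measure_integrable_cst P (L * `|xi|)).
apply: le_integrable iB => //.
  apply/measurable_EFinP; apply: measurableT_comp => //.
  exact: measurable_funB.
move=> w _; rewrite [leRHS]gee0_abs ?adde_ge0 ?lee_fin ?mulr_ge0//.
(* The Lipschitz bound [L |xi|] combines with the reverse triangle inequality. *)
have := phiL (X w - xi) (X w); rewrite addrAC subrr sub0r normrN => h.
rewrite -lerBlDl; apply: le_trans h; exact: lerB_dist.
Qed.

Lemma expectation_lipschitz_le (X Y : {RV P >-> R}) (xi : R) :
    P.-integrable [set: T] (EFin \o (phi \o X)) ->
    P.-integrable [set: T] (EFin \o (phi \o Y)) ->
    P.-integrable [set: T] (fun w => `|X w - Y w|%:E) ->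
  'E_P[fun w => phi (X w - xi)%R] <=
  'E_P[fun w => phi (Y w - xi)%R] + L%:E * \int[P]_w `|X w - Y w|%:E.
Proof.
move=> iX iY iXY; rewrite unlock.
have iL : P.-integrable [set: T] (fun w => L%:E * `|X w - Y w|%:E).
  exact: integrableZl.
rewrite -ge0_integralZl//; last exact: (measurable_int _ iXY).
rewrite -integralD//; last exact: integrable_lipschitz_shift.
apply: le_integral => //; first exact: integrable_lipschitz_shift.
  by apply: integrableD => //; exact: integrable_lipschitz_shift.
move=> w _; rewrite -EFinM -EFinD lee_fin -lerBlDl.
apply: le_trans (ler_norm _) (le_trans (phiL _ _) _).
by rewrite opprB addrA subrK.
Qed.

Lemma oce_sub_le (X Y : {RV P >-> R}) :
    P.-integrable [set: T] (EFin \o (phi \o X)) ->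
    P.-integrable [set: T] (EFin \o (phi \o Y)) ->
    P.-integrable [set: T] (fun w => `|X w - Y w|%:E) ->
  oce phi X - L%:E * \int[P]_w `|X w - Y w|%:E <= oce phi Y.
Proof.
move=> iX iY iXY; apply: le_ereal_inf_tmp => _ [xi _ <-].
(* Moving the cost across the inequality is legitimate in the extended reals because it is
   finite. *)
rewrite leeBlDr; last by rewrite fin_numM// integrable_fin_num.
rewrite -addeA; apply: ge_ereal_inf.
(* The shift [xi] given for [Y] serves as competitor in the infimum for [X]. *)
exists (xi%:E + 'E_P[fun w => phi (X w - xi)%R]); first by exists xi.
exact/leeD2l/expectation_lipschitz_le.
Qed.

End lipschitz.

Section coupling_bound.
Context (R : realType) (phi : R -> R) (L : R).
Hypotheses (L0 : (0 < L)%R) (mphi : measurable_fun [set: R] phi)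
  (phiL : forall x y, (`|phi x - phi y| <= L * `|x - y|)%R).

Lemma dist_oce_le_same_space (d : measure_display) (T : measurableType d)
    (P : probability T R) (X Y : {RV P >-> R}) :
    P.-integrable [set: T] (EFin \o (phi \o X)) ->
    P.-integrable [set: T] (EFin \o (phi \o Y)) ->
    oce phi X \is a fin_num -> oce phi Y \is a fin_num ->
  `|oce phi X - oce phi Y| <= L%:E * \int[P]_w `|X w - Y w|%:E.
Proof.
move=> iX iY fX fY.
have mXY : measurable_fun [set: T] (fun w => `|X w - Y w|%:E).
  apply/measurable_EFinP; apply: measurableT_comp => //.
  exact: measurable_funB.
(* If the cost is infinite, so is its product with [L > 0], and the bound is trivial. *)
have [oo|fin] := eqVneq (\int[P]_w `|X w - Y w|%:E) +oo.
  by rewrite oo gt0_muley ?leey.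
have iXY : P.-integrable [set: T] (fun w => `|X w - Y w|%:E).
  apply/integrableP; split => //.
  by under eq_integral do rewrite gee0_abs//; rewrite ltey.
have iYX : P.-integrable [set: T] (fun w => `|Y w - X w|%:E).
  by under eq_fun do rewrite distrC.
have cYX : \int[P]_w `|Y w - X w|%:E = \int[P]_w `|X w - Y w|%:E.
  by apply: eq_integral => w _; rewrite distrC.
have := @oce_sub_le _ _ _ (ltW L0) mphi phiL _ _ _ _ _ iX iY iXY.
have := @oce_sub_le _ _ _ (ltW L0) mphi phiL _ _ _ _ _ iY iX iYX.
have := integrable_fin_num measurableT iXY; rewrite cYX.
move: fX fY; case: (oce phi X) => [x||]// _; case: (oce phi Y) => [y||]// _.
case: (\int[P]_w _) => [c||]// _.
rewrite -!EFinM -!EFinB !lee_fin => xy yx.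
by rewrite ler_norml lerBlDr -lerBlDl yx andbT lerBrDr addrC.
Qed.

(** [X] and [Y] may live on different probability spaces. The coordinates [U] and [V] share the
    space of [pi] and have the same CDFs as [X] and [Y], so the bound on a common space transfers by
    law invariance. *)
Lemma dist_oce_le_coupling (dX dY : measure_display)
    (TX : measurableType dX) (TY : measurableType dY)
    (PX : probability TX R) (PY : probability TY R)
    (X : {RV PX >-> R}) (Y : {RV PY >-> R})
    (pi : probability (R * R)%type R) :
    PX.-integrable [set: TX] (EFin \o (phi \o X)) ->
    PY.-integrable [set: TY] (EFin \o (phi \o Y)) ->
    oce phi X \is a fin_num -> oce phi Y \is a fin_num ->
    coupling (cdf X) (cdf Y) pi ->
  `|oce phi X - oce phi Y| <= L%:E * \int[pi]_z `|z.1 - z.2|%:E.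
Proof.
move=> iX iY fX fY [piX piY].
pose U : {RV pi >-> R} := mfun_Sub (mem_set measurable_fst).
pose V : {RV pi >-> R} := mfun_Sub (mem_set measurable_snd).
have XU : cdf X =1 cdf U. by move=> s; rewrite -piX.
have YV : cdf Y =1 cdf V. by move=> s; rewrite -piY.
have mE : measurable_fun [set: R] (EFin \o phi) by exact/measurable_EFinP.
rewrite (oce_eq_cdf XU mphi) in fX *; rewrite (oce_eq_cdf YV mphi) in fY *.
apply: (@dist_oce_le_same_space _ _ pi U V) => //.
- exact: (integrable_eq_cdf XU mE iX).
- exact: (integrable_eq_cdf YV mE iY).
Qed.

End coupling_bound.

Theorem lemma12 (R : realType) (phi : R -> R) (L : R)
  (phi_nd : nondecreasing_fun phi)
  (phi_convex : convex_function [set: R^o] (phi : R^o -> R^o))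
  (L_gt0 : (0 < L)%R)
  (phi_lip : L.-lipschitz phi)
  (dX : measure_display) (TX : measurableType dX) (PX : probability TX R)
  (X : {RV PX >-> R})
  (dY : measure_display) (TY : measurableType dY) (PY : probability TY R)
  (Y : {RV PY >-> R})
  (phiX_int : PX.-integrable [set: TX] (EFin \o (phi \o X)))
  (phiY_int : PY.-integrable [set: TY] (EFin \o (phi \o Y)))
  (oceX_fin : oce phi X \is a fin_num)
  (oceY_fin : oce phi Y \is a fin_num) :
  `|oce phi X - oce phi Y| <= L%:E * W1 (cdf X) (cdf Y).
Proof.
have mphi : measurable_fun [set: R] phi by exact: nondecreasing_measurable.
(* Dividing by [L > 0] isolates the infimum, so that it suffices to bound the cost of each coupling
   from below; [L] is then moved back. *)
rewrite -lee_pdivrMl//; apply: le_ereal_inf_tmp => _ [pi piXY <-].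
rewrite lee_pdivrMl//; apply: dist_oce_le_coupling => // x y.
exact: (phi_lip (x, y)).
Qed.
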